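(* For every integer $n\geqslant 4$, the monoid $\mathrm{PEnd}(S_n)$ of all partial endomorphisms of the star graph $S_n$ has rank $7$.
   Context: For $n\geqslant1$, the star graph $S_n$ is the simple graph with vertex set $\{0,1,\ldots,n-1\}$ and edge set $E=\{\{0,i\}\mid 1\leqslant i\leqslant n-1\}$ (so $n$ vertices). $\mathcal{PT}(V)$ denotes the monoid of all partial transformations (partial maps $V\to V$, including the empty one) of a finite set $V$ under composition; maps are written on the right and composed left to right. For a graph $G=(V,E)$, a map $\alpha\in\mathcal{PT}(V)$ is a partial endomorphism of $G$ if for all $u,v\in\mathrm{Dom}(\alpha)$: $\{u,v\}\in E$ implies $\{u\alpha,v\alpha\}\in E$. $\mathrm{PEnd}(G)$ is the set of all of them; it is a submonoid of $\mathcal{PT}(V)$. The rank of a finite monoid $M$ is the minimum size of a generating set of $M$ (as a monoid). *)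

(* Defs.v *)
From HB Require Import structures.
From mathcomp Require Import all_boot.

Set Implicit Arguments.
Unset Strict Implicit.
Unset Printing Implicit Defensive.

Local Open Scope group_scope.

HB.structure Definition FinMonoid := {M of Monoid M & Finite M}.
Notation finMonoidType := FinMonoid.type.

Section MonoidRank.

Variable M : finMonoidType.
Implicit Types A B : {set M}.

Definition submonoid B : bool :=
  (1 \in B) && [forall x in B, forall y in B, x * y \in B].

Definition generated_submonoid A : {set M} :=
  \bigcap_(B : {set M} | submonoid B && (A \subset B)) B.

Definition generating A : bool := generated_submonoid A == [set: M].

Definition monoid_rank : nat :=
  #|[arg min_(A < [set: M] | generating A) #|A|]|.

Lemma submonoidP B : reflect (umagma_closed B) (submonoid B).
Proof.
apply: (iffP andP) => -[B1 BM]; split=> //.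
  by move=> x y Bx By; apply: (forall_inP (forall_inP BM x Bx) y By).
by apply/forall_inP=> x Bx; apply/forall_inP=> y By; apply: BM.
Qed.

Lemma submonoid_generated A : submonoid (generated_submonoid A).
Proof.
apply/submonoidP; split=> [|x y /bigcapP-Ax /bigcapP-Ay].
  by apply/bigcapP=> B /andP[/andP[]].
apply/bigcapP=> B sAB; have /andP[/submonoidP[_ BM] _] := sAB.
by apply: BM; [apply: Ax | apply: Ay].
Qed.

Lemma generatingP A :
  reflect (forall B, submonoid B -> A \subset B -> B = [set: M])
          (generating A).
Proof.
apply: (iffP eqP) => [gA B smB sAB | gA].
  by apply/eqP; rewrite -subTset -gA; apply: bigcap_inf; rewrite smB.
by apply: gA; [apply: submonoid_generated | apply/bigcapsP=> B /andP[]].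
Qed.

(* The default value of the arg min in monoid_rank satisfies its condition. *)
Lemma generatingT : generating [set: M].
Proof. by apply/generatingP=> B _; rewrite subTset => /eqP. Qed.

Lemma monoid_rankP r :
  monoid_rank = r <->
  (exists2 A, generating A & #|A| = r)
  /\ (forall A, generating A -> r <= #|A|).
Proof.
rewrite /monoid_rank; case: arg_minnP => [|A gA minA]; first exact: generatingT.
split=> [<- | [[B gB <-] minB]]; first by split=> //; exists A.
by apply/eqP; rewrite eqn_leq minA ?minB.
Qed.

End MonoidRank.

(* The partial transformation [a] of [V] is undefined at [u] when
   [a u = None]. *)
Definition PT (V : finType) : Type := {ffun V -> option V}.

HB.instance Definition _ (V : finType) := Finite.on (PT V).

Definition PT_app (V : finType) (a : PT V) (u : V) : option V :=
  (a : {ffun V -> option V}) u.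

Coercion PT_app : PT >-> Funclass.

Section PTMonoid.

Variable V : finType.

Definition Dom (a : PT V) : {set V} := [set u | isSome (a u)].

Definition PT_one : PT V := [ffun u => Some u].

(* Maps act on the right: [PT_mul a b] applies [a] first, then [b]. *)
Definition PT_mul (a b : PT V) : PT V := [ffun u => obind b (a u)].

Lemma PT_oneE u : PT_one u = Some u. Proof. exact: ffunE. Qed.

Lemma PT_mulE a b u : PT_mul a b u = obind b (a u). Proof. exact: ffunE. Qed.

Lemma PT_ext (a b : PT V) : a =1 b -> a = b.
Proof. by move=> eq_ab; apply/ffunP. Qed.

Lemma PT_mulA : associative PT_mul.
Proof.
move=> a b c; apply: PT_ext => u; rewrite !PT_mulE.
by case: (a u) => //= v; rewrite PT_mulE.
Qed.

Lemma PT_mul1l : left_id PT_one PT_mul.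
Proof. by move=> a; apply: PT_ext => u; rewrite PT_mulE PT_oneE. Qed.

Lemma PT_mul1r : right_id PT_one PT_mul.
Proof.
move=> a; apply: PT_ext => u; rewrite PT_mulE.
by case: (a u) => //= v; rewrite PT_oneE.
Qed.

HB.instance Definition _ :=
  isMonoid.Build (PT V) PT_mulA PT_mul1l PT_mul1r.

End PTMonoid.

Record sgraph := SGraph {
  vertex :> finType;
  edge : rel vertex;
  edge_sym : symmetric edge;
  edge_irr : irreflexive edge }.

Section PartialEndomorphisms.

Variable G : sgraph.

Definition partial_endo : pred (PT G) := fun a =>
  [forall u in Dom a, forall v in Dom a,
     edge u v ==> if (a u, a v) is (Some u', Some v') then edge u' v'
                  else false].

Lemma partial_endoP (a : PT G) :
  reflect (forall u v u' v', a u = Some u' -> a v = Some v' ->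
             edge u v -> edge u' v')
          (partial_endo a).
Proof.
apply: (iffP forall_inP) => [aE u v u' v' au av uv | aE u].
  have /aE/forall_inP/(_ v) : u \in Dom a by rewrite inE au.
  by rewrite inE av au uv => /(_ isT).
rewrite inE; case au: (a u) => [u'|] // _; apply/forall_inP=> v.
rewrite inE; case av: (a v) => [v'|] // _.
by apply/implyP; apply: aE au av.
Qed.

Lemma partial_endo1 : partial_endo 1.
Proof.
by apply/partial_endoP=> u v u' v'; rewrite !PT_oneE => -[<-] [<-].
Qed.

Lemma partial_endoM (a b : PT G) :
  partial_endo a -> partial_endo b -> partial_endo (a * b).
Proof.
move=> /partial_endoP-aE /partial_endoP-bE; apply/partial_endoP=> u v u' v'.
rewrite !PT_mulE; case au: (a u) => [u1|] //=; case av: (a v) => [v1|] //=.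
by move=> bu bv uv; apply: (bE _ _ _ _ bu bv); apply: (aE _ _ _ _ au av).
Qed.

Lemma partial_endo_closed : umagma_closed partial_endo.
Proof. by split; [apply: partial_endo1 | apply: partial_endoM]. Qed.

Definition PEnd : Type := {a : PT G | partial_endo a}.

HB.instance Definition _ := SubFinite.copy PEnd {a : PT G | partial_endo a}.
HB.instance Definition _ :=
  SubChoice_isSubMonoid.Build (PT G) partial_endo PEnd partial_endo_closed.

End PartialEndomorphisms.

Definition star_edge n : rel 'I_n := fun u v =>
  ((u == 0 :> nat) && (0 < v)) || ((v == 0 :> nat) && (0 < u)).

Lemma star_edge_sym n : symmetric (@star_edge n).
Proof. by move=> u v; rewrite /star_edge orbC. Qed.

Lemma star_edge_irr n : irreflexive (@star_edge n).
Proof. by move=> u; rewrite /star_edge orbb lt0n andbN. Qed.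

Definition star_graph n : sgraph :=
  SGraph (@star_edge_sym n) (@star_edge_irr n).

(* Main.v *)
(* Write 0 for the hub of the star and L for its set of m = n - 1 leaves.

   Seven elements generate. Those fixing 0 form a copy of PT(L), generated by
   two permutations, an idempotent of rank m - 1 folding one leaf onto another,
   and the identity with one leaf dropped. Those with 0 mapped to a leaf send
   all other points of their domain to 0, hence factor through the total map
   swapping 0 with the leaves. Those undefined at 0 factor through the identity
   of L, or, if 0 is in the image, so that some leaf x is not, through the map
   sending x to 0 and fixing the other leaves.

   Seven are needed: there are five pairwise disjoint sets X of non-units such
   that ab in X implies a in X or b in X, so that every generating set meets
   each X. Generators that are units generate the group of units, which is
   Sym(L) and not commutative since m >= 3, so there are at least two. *)

Require Import Defs.
From mathcomp Require Import all_boot perm fingroup ssralg zmodp.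

Set Implicit Arguments.
Unset Strict Implicit.
Unset Printing Implicit Defensive.

Local Open Scope group_scope.

(** * Generation of the monoid of partial transformations of a finite set *)

Section PartialTransformations.

Variable T : finType.
Implicit Types (s t : {perm T}) (f g : PT T) (x y : T) (o : option T).

Definition PT_perm s : PT T := [ffun u => Some (s u)].

(** One form for both kinds of elementary map: folding [x] onto another point, and dropping [x] when
    [o] is [None]. *)
Definition PT_upd x o : PT T := [ffun u => if u == x then o else Some u].

Lemma PT_permE s u : PT_perm s u = Some (s u). Proof. exact: ffunE. Qed.

Lemma PT_updE x o u : PT_upd x o u = if u == x then o else Some u.
Proof. exact: ffunE. Qed.

Lemma PT_permM s t : PT_perm (s * t) = PT_perm s * PT_perm t.
Proof. by apply: PT_ext => u; rewrite PT_mulE !PT_permE /= PT_permE permM. Qed.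

Lemma PT_updJ s x o :
  PT_perm s * PT_upd (s x) (omap s o) * PT_perm s^-1 = PT_upd x o.
Proof.
apply: PT_ext => u; rewrite !PT_mulE PT_permE /= !PT_updE (inj_eq perm_inj).
case: eqP => _ /=; last by rewrite PT_permE permK.
by case: o => //= y; rewrite PT_permE permK.
Qed.

Lemma perm_pair x x' y y' :
  x != x' -> y != y' -> exists s, s x = y /\ s x' = y'.
Proof.
move=> xx' yy'; exists (tperm x y * tperm (tperm x y x') y').
rewrite !permM !tpermL; split=> //; rewrite tpermD //; last by rewrite eq_sym.
by rewrite -{2}(tpermL x y) (inj_eq perm_inj) eq_sym.
Qed.

(** If [x] is undefined or shares its value, the other points already give every value of [f], too
    few to cover [T], so some [y] is missed. If no such [x] exists, [f] is total and injective. *)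
Lemma PT_fold_or_perm f :
  (exists s, f = PT_perm s) \/
  exists x y, (forall u, f u != Some y) /\
    (f x = None \/ exists2 x', x' != x & f x' = f x).
Proof.
have [/existsP[x /orP xP]|] :=
  boolP [exists x, (f x == None) || [exists x', (x' != x) && (f x' == f x)]].
  right; exists x.
  have xP' : f x = None \/ exists2 x', x' != x & f x' = f x.
    case: xP => [/eqP-> | /existsP[x' /andP[? /eqP ?]]]; first by left.
    by right; exists x'.
  have [/existsP[y /forallP yP]|/existsPn onto] :=
    boolP [exists y, [forall u, f u != Some y]]; first by exists y.
  have sub : [set Some u | u in [set: T]] \subset
             [set f u | u in [set: T] :\ x].
    apply/subsetP=> _ /imsetP[y _ ->].
    have /forallPn[u] := onto y; rewrite negbK => /eqP fu.
    have [ux|u_x] := eqVneq u x; last by apply/imsetP; exists u; rewrite ?inE ?u_x.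
    case: xP' => [fx|[x' xx' fx']]; first by rewrite -ux fu in fx.
    by apply/imsetP; exists x'; rewrite ?inE ?xx' // fx' -ux.
  have := subset_leq_card sub.
  rewrite card_imset; last by move=> ? ? [].
  move=> /leq_trans/(_ (leq_imset_card _ _)).
  by rewrite [X in X <= _](cardsD1 x) inE ltnn.
move=> /existsPn fP; left.
pose p u := odflt u (f u).
have fp u : f u = Some (p u).
  by rewrite /p; case: (f u) (fP u) => [v|] //=.
have p_inj : injective p.
  move=> u v puv; apply/eqP; apply: contraTT isT => uv.
  have /norP[_ /existsPn/(_ v)] := fP u.
  by rewrite eq_sym uv !fp puv eqxx.
by exists (perm p_inj); apply: PT_ext => u; rewrite PT_permE permE fp.
Qed.

(* Downward induction on the size of the image: if [f] is not a permutation
   then [f = PT_upd x o * f'], where [f'] differs from [f] only at [x], which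
   it sends to a point outside the image of [f]. *)
Lemma PT_generated_upd (B : {pred PT T}) :
  umagma_closed B -> (forall s, PT_perm s \in B) ->
  (forall x o, o != Some x -> PT_upd x o \in B) -> forall f, f \in B.
Proof.
case=> _ BM Bperm Bupd f.
have [m] := ubnP #|[set y | [forall u, f u != Some y]]|.
elim: m f => // m IH f; rewrite ltnS => le_m.
have [[s ->] // | [x [y [fy xP]]]] := PT_fold_or_perm f.
pose f' : PT T := [ffun u => if u == x then Some y else f u].
have f'E u : f' u = if u == x then Some y else f u by exact: ffunE.
have f'B : f' \in B.
  apply: IH; apply: leq_trans le_m; apply/proper_card/properP; split.
    apply/subsetP=> v; rewrite !inE => /forallP f'v; apply/forallP=> u.
    have := f'v u; rewrite f'E; have [->{u} yv|//] := eqVneq u x.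
    case: xP => [->//|[x' xx' <-]].
    by have := f'v x'; rewrite f'E (negPf xx').
  exists y; rewrite !inE; first exact/forallP.
  by apply/forallPn; exists x; rewrite f'E eqxx negbK.
have [o ox ->] : exists2 o, o != Some x & f = PT_upd x o * f'.
  case: xP => [fx|[x' xx' fx']]; [exists None|exists (Some x')] => //;
    apply: PT_ext => u; rewrite PT_mulE PT_updE;
    case: eqP => [->|/eqP ux] //=; by rewrite ?f'E ?(negPf ux) ?(negPf xx').
by apply: BM => //; apply: Bupd.
Qed.

(** Permutations act transitively on points and on ordered pairs of distinct points, so conjugation
    turns one drop and one fold into all of them. *)
Lemma PT_generated (x y : T) (B : {pred PT T}) :
  x != y -> umagma_closed B -> (forall s, PT_perm s \in B) ->
  PT_upd x None \in B -> PT_upd x (Some y) \in B -> forall f, f \in B.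
Proof.
move=> xy Bcl Bperm BN BS; apply: PT_generated_upd => // z [w|] zw.
  have [s [sz sw]] : exists s, s z = x /\ s w = y.
    by apply: perm_pair; rewrite // eq_sym.
  by rewrite -(PT_updJ s) /= sz sw; case: Bcl => _ BM; rewrite !BM.
rewrite -(PT_updJ (tperm z x)) tpermL; by case: Bcl => _ BM; rewrite !BM.
Qed.

End PartialTransformations.

(** * Elements that every generating set must contain *)

Section GeneratingSets.

Variables (N : finMonoidType) (A : {set N}) (X : pred N).
Hypothesis genA : generating A.

Lemma generating_ind (P : pred N) : P 1 ->
  (forall a b, P a -> P b -> P (a * b)) -> (forall a, a \in A -> P a) ->
  forall a, P a.
Proof.
move=> P1 PM AP a; suff PT : [set x | P x] = [set: N] by rewrite -[P a]inE PT inE.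
apply: (generatingP _ genA).
  by apply/submonoidP; split=> [|x y]; rewrite !inE //; apply: PM.
by apply/subsetP=> x Ax; rewrite inE AP.
Qed.

(** The complement of [X] is a submonoid; it is proper, so it cannot contain [A]. *)
Lemma generating_meets_prime : ~~ X 1 ->
  (forall a b, X (a * b) -> X a || X b) -> (exists a, X a) ->
  exists2 a, a \in A & X a.
Proof.
move=> X1 XM [c Xc].
have [/existsP[a /andP[Aa Xa]]|/existsPn AX] :=
  boolP [exists a, (a \in A) && X a]; first by exists a.
suff /negP : ~~ X c by [].
apply: (generating_ind (P := fun a => ~~ X a)) => // [a b Xa Xb|a Aa].
  by apply/negP=> /XM; rewrite (negPf Xa) (negPf Xb).
by have := AX a; rewrite Aa.
Qed.

(* Otherwise the single generator in [X] commutes with all of [X], hence so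
   does every element of [X]. *)
Lemma generating_meets_noncommutative :
  (forall a b, X (a * b) -> X a && X b) ->
  (exists a b, [/\ X a, X b & a * b != b * a]) ->
  exists a b, [/\ a \in A, b \in A, X a, X b & a != b].
Proof.
move=> XM [c [d [Xc Xd /eqP cd]]].
have [/existsP[a /existsP[b /and5P[]]]|/existsPn AX] :=
  boolP [exists a, exists b, [&& a \in A, b \in A, X a, X b & a != b]].
  by exists a, b.
have eqAX a b : a \in A -> b \in A -> X a -> X b -> a = b.
  move=> Aa Ab Xa Xb; have /existsPn/(_ b) := AX a.
  by rewrite Aa Ab Xa Xb negbK => /eqP.
(* Commuting with all of [P] passes from the generators in [X] to every element of [X]. It is used
   with [P] equal to [X], and inside that with [P] the single generator. *)
have comm_sub (P : pred N) :
    (forall a, a \in A -> X a -> forall g, P g -> a * g = g * a) ->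
  forall a, X a -> forall g, P g -> a * g = g * a.
  move=> AP a Xa g Pg.
  apply/eqP; apply: implyP Xa.
  apply: (generating_ind (P := fun a => X a ==> (a * g == g * a))) => [|x y|x Ax].
  - by rewrite mul1g mulg1 eqxx implybT.
  - move=> /implyP xg /implyP yg; apply/implyP=> /XM/andP[/xg/eqP xgE /yg/eqP ygE].
    by rewrite -mulgA ygE !mulgA xgE.
  - by apply/implyP=> Xx; rewrite (AP x).
case: cd; apply: (comm_sub X) => // a Aa Xa g Xg.
apply/esym; apply: (comm_sub (pred1 a)) => //= b Ab Xb _ /eqP->.
by rewrite (eqAX a b).
Qed.

End GeneratingSets.

(** * Partial endomorphisms of the star in terms of hub and leaves *)

Section Star.

Variable k : nat.
Local Notation leaves := 'I_k.+3.
Local Notation V := 'I_k.+4.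
Local Notation M := (PEnd (star_graph k.+4)).
Implicit Types (i j x y : leaves) (s t : 'S_k.+3) (o : option leaves).
Implicit Types (a b c : M) (p : PT leaves) (h : option V) (l : leaves -> option V).

Definition hub : V := ord0.
Definition leaf i : V := lift ord0 i.

Definition endo_app a (u : V) : option V := (val a : PT (star_graph k.+4)) u.
Local Notation "a @ u" := (endo_app a u) (at level 15).

Lemma leaf_inj : injective leaf. Proof. exact: lift_inj. Qed.

Variant vertex_spec : V -> Type :=
  | VertexHub : vertex_spec hub
  | VertexLeaf i : vertex_spec (leaf i).

Lemma vertexP v : vertex_spec v.
Proof. by case: (unliftP ord0 v) => [i|] ->; constructor. Qed.

Lemma edgeE (u v : V) : @star_edge k.+4 u v = ((u == hub) (+) (v == hub)).
Proof. by case: (vertexP u) => [|i]; case: (vertexP v). Qed.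

Lemma endoP a i u v : a @ hub = Some u -> a @ leaf i = Some v ->
  (u == hub) (+) (v == hub).
Proof.
move=> ah ai; rewrite -edgeE.
by have /partial_endoP aE := valP a; apply: aE ah ai _; rewrite /= edgeE.
Qed.

Lemma endoM a b u : (a * b) @ u = obind (endo_app b) (a @ u).
Proof. exact: PT_mulE. Qed.

Lemma endo1 u : 1 @ u = Some u. Proof. exact: PT_oneE. Qed.

Lemma endo_ext a b :
  a @ hub = b @ hub -> (forall i, a @ leaf i = b @ leaf i) -> a = b.
Proof.
by move=> abh abl; apply/val_inj/PT_ext=> v; case: (vertexP v) => [|i];
  [apply: abh | apply: abl].
Qed.

Definition star_map h l : PT (star_graph k.+4) :=
  [ffun v : V => if unlift ord0 v is Some i then l i else h].

Lemma star_map_hub h l : star_map h l hub = h.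
Proof. by rewrite [LHS]ffunE unlift_none. Qed.

Lemma star_map_leaf h l i : star_map h l (leaf i) = l i.
Proof. by rewrite [LHS]ffunE liftK. Qed.

(** Every edge joins the hub to a leaf, so these pairs are the only ones to check. *)
Lemma star_map_endo h l :
  (forall i u v, h = Some u -> l i = Some v -> (u == hub) (+) (v == hub)) ->
  partial_endo (star_map h l).
Proof.
move=> hlE; apply/partial_endoP=> u v u' v'; rewrite /= !edgeE.
case: (vertexP u) => [|i]; case: (vertexP v) => [|j] //;
  rewrite ?star_map_hub ?star_map_leaf => hu lv _; first exact: hlE hu lv.
by rewrite addbC; apply: hlE lv hu.
Qed.

Definition star_endo h l
    (hl : forall i u v, h = Some u -> l i = Some v ->
            (u == hub) (+) (v == hub)) : M :=
  Sub (star_map h l) (star_map_endo hl).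

Lemma star_endo_hub h l hl : @star_endo h l hl @ hub = h.
Proof. by rewrite /endo_app SubK star_map_hub. Qed.

Lemma star_endo_leaf h l hl i : @star_endo h l hl @ leaf i = l i.
Proof. by rewrite /endo_app SubK star_map_leaf. Qed.

(** * Building blocks for the generators *)

Lemma fix_hub_subproof p i u v :
  Some hub = Some u -> omap leaf (p i) = Some v -> (u == hub) (+) (v == hub).
Proof. by case: (p i) => // j [<-] [<-]. Qed.

Definition fix_hub p : M := star_endo (@fix_hub_subproof p).

Lemma fix_hubE p : fix_hub p @ hub = Some hub.
Proof. exact: star_endo_hub. Qed.

Lemma fix_hub_leaf p i : fix_hub p @ leaf i = omap leaf (p i).
Proof. exact: star_endo_leaf. Qed.

Lemma fix_hubM p q : fix_hub (p * q) = fix_hub p * fix_hub q.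
Proof.
apply: endo_ext => [|i]; rewrite endoM.
  by rewrite !fix_hubE /= fix_hubE.
by rewrite !fix_hub_leaf PT_mulE; case: (p i) => //= j; rewrite fix_hub_leaf.
Qed.

Lemma fix_hub1 : fix_hub 1 = 1.
Proof.
by apply: endo_ext => [|i]; rewrite endo1 ?fix_hubE ?fix_hub_leaf ?PT_oneE.
Qed.

Definition perm_endo s : M := fix_hub (PT_perm s).

Lemma perm_endo_leaf s i : perm_endo s @ leaf i = Some (leaf (s i)).
Proof. by rewrite fix_hub_leaf PT_permE. Qed.

Lemma perm_endo1 : perm_endo 1 = 1.
Proof.
by apply: endo_ext => [|i]; rewrite ?fix_hubE ?perm_endo_leaf ?endo1 ?perm1.
Qed.

Lemma perm_endoM s t : perm_endo (s * t) = perm_endo s * perm_endo t.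
Proof. by rewrite /perm_endo PT_permM fix_hubM. Qed.

(** Without the hub in the domain no edge is left to preserve, so [l] is arbitrary. *)
Definition drop_hub l : M :=
  @star_endo None l
    (fun _ _ _ (e : None = Some _) => match e with erefl => isT end).

Lemma drop_hubE l : drop_hub l @ hub = None. Proof. exact: star_endo_hub. Qed.

Lemma drop_hub_leaf l i : drop_hub l @ leaf i = l i.
Proof. exact: star_endo_leaf. Qed.

Definition leaves_id : M := drop_hub (fun i => Some (leaf i)).

Definition leaf_to_hub x : M :=
  drop_hub (fun i => if i == x then Some hub else Some (leaf i)).

Lemma swap_hub_subproof (i : leaves) u v :
  Some (leaf ord0) = Some u -> Some hub = Some v -> (u == hub) (+) (v == hub).
Proof. by move=> [<-] [<-]. Qed.

Definition swap_hub : M := star_endo swap_hub_subproof.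

Lemma swap_hubE : swap_hub @ hub = Some (leaf ord0).
Proof. exact: star_endo_hub. Qed.

Lemma swap_hub_leaf i : swap_hub @ leaf i = Some hub.
Proof. exact: star_endo_leaf. Qed.

(** The full cycle on the leaves, as translation by 1 in the integers modulo [k.+3]. *)
Definition leaf_shift : 'S_k.+3 := perm (GRing.addrI (1%R : leaves)).

(** * The seven elements generate *)

Definition star_gens : {set M} :=
  [set a in [:: perm_endo (tperm ord0 (lift ord0 ord0));
                perm_endo leaf_shift;
                fix_hub (PT_upd ord0 None);
                fix_hub (PT_upd ord0 (Some (lift ord0 ord0)));
                leaves_id; leaf_to_hub ord0; swap_hub]].

Lemma perm_endo_generated (B : {pred M}) : umagma_closed B ->
  perm_endo (tperm ord0 (lift ord0 ord0)) \in B ->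
  perm_endo leaf_shift \in B ->
  forall s, perm_endo s \in B.
Proof.
move=> [B1 BM] Bt Bc s.
have gK : group_set [set t | perm_endo t \in B].
  apply/group_setP; split=> [|t u]; rewrite !inE.
    by rewrite perm_endo1.
  by rewrite perm_endoM; apply: BM.
suff /subsetP/(_ s) : [set: 'S_k.+3] \subset Group gK by rewrite !inE; apply.
rewrite -(@gen_tpermn_circular_shift k.+1 ord0 (lift ord0 ord0)) ?gen_subG.
  by apply/subsetP=> t /set2P[] ->; rewrite inE.
(* A transposition and the full cycle generate when the two swapped points differ by a number
   coprime to the cycle length; here they differ by 1. *)
by rewrite GRing.subr0 coprimen1.
Qed.

Lemma perm_endoM_leaf s a i :
  (perm_endo s * a) @ leaf i = a @ leaf (s i).
Proof. by rewrite endoM perm_endo_leaf. Qed.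

(** Pigeonhole: there is one leaf fewer than vertices, so the leaves cannot reach all vertices, and
    the hub is reached. *)
Lemma missed_leaf a i : a @ leaf i = Some hub ->
  exists x, forall j, a @ leaf j != Some (leaf x).
Proof.
move=> ai; have [/existsP[x /forallP]|/existsPn onto] :=
  boolP [exists x, [forall j, a @ leaf j != Some (leaf x)]]; first by exists x.
have : [set Some v | v in [set: V]] \subset [set a @ leaf j | j in [set: leaves]].
  apply/subsetP=> _ /imsetP[v _ ->]; case: (vertexP v) => [|x].
    by apply/imsetP; exists i; rewrite ?inE.
  have /forallPn[j /negPn/eqP ja] := onto x.
  by apply/imsetP; exists j; rewrite ?inE.
move/subset_leq_card; rewrite card_imset; last by move=> ? ? [].
move/leq_trans/(_ (leq_imset_card _ _)).
by rewrite !cardsT !card_ord ltnn.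
Qed.

(** Leaves sent to the hub leave the domain, since [unlift ord0] is [None] at the hub. *)
Definition leaf_part a : PT leaves := [ffun i => obind (unlift ord0) (a @ leaf i)].

Lemma leaf_partE a i : leaf_part a i = obind (unlift ord0) (a @ leaf i).
Proof. exact: ffunE. Qed.

Lemma generating_star_gens : generating star_gens.
Proof.
apply/generatingP=> B /submonoidP Bcl /subsetP sAB; have [B1 BM] := Bcl.
have Bperm : forall s, perm_endo s \in B.
  by apply: perm_endo_generated => //; apply: sAB; rewrite !inE eqxx ?orbT.
have Bfix : forall p, fix_hub p \in B.
  apply: (@PT_generated _ ord0 (lift ord0 ord0) [pred p | fix_hub p \in B]) => //.
  - split=> [|p q]; rewrite !inE ?fix_hub1 // fix_hubM; exact: BM.
  - by rewrite inE sAB // !inE eqxx ?orbT.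
  - by rewrite inE sAB // !inE eqxx ?orbT.
have Bid : leaves_id \in B by apply: sAB; rewrite !inE eqxx ?orbT.
have Bto x : leaf_to_hub x \in B.
  have -> : leaf_to_hub x =
      perm_endo (tperm x ord0) * leaf_to_hub ord0 * perm_endo (tperm x ord0).
    apply: endo_ext => [|i]; rewrite !endoM.
      by rewrite fix_hubE /= !drop_hubE.
    rewrite perm_endo_leaf /= !drop_hub_leaf.
    rewrite -{3}(tpermL x ord0) (inj_eq perm_inj).
    by case: eqP => _ /=; rewrite ?fix_hubE ?perm_endo_leaf ?tpermK.
  by rewrite !BM // sAB // !inE eqxx ?orbT.
apply/setP=> a; rewrite [RHS]inE; case ah: (a @ hub) => [v|].
  case: (vertexP v) ah => [|j] ah.
    suff -> : a = fix_hub (leaf_part a) by apply: Bfix.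
    apply: endo_ext => [|i]; first by rewrite fix_hubE.
    rewrite fix_hub_leaf leaf_partE; case ai: (a @ leaf i) => [w|] //=.
    have := endoP ah ai; case: (vertexP w) => // x _.
    by rewrite liftK.
  (* When the hub goes to a leaf [j], all other values are the hub, so [a] is determined by [j] and
     its domain. [D] is the identity on the leaves of that domain. *)
  pose D : PT leaves := [ffun i => omap (fun _ => i) (a @ leaf i)].
  have DE i : D i = omap (fun _ => i) (a @ leaf i) by exact: ffunE.
  suff -> : a = fix_hub D * swap_hub * perm_endo (tperm ord0 j).
    by rewrite !BM // sAB // !inE eqxx ?orbT.
  apply: endo_ext => [|i]; rewrite !endoM.
    by rewrite fix_hubE /= swap_hubE /= perm_endo_leaf tpermL.
  rewrite fix_hub_leaf DE; case ai: (a @ leaf i) => [w|] //=.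
  rewrite swap_hub_leaf /= fix_hubE.
  by have := endoP ah ai; case: (vertexP w).
have [/existsP[i0 /eqP ai0]|/existsPn noh] :=
  boolP [exists i, a @ leaf i == Some hub]; last first.
  suff -> : a = leaves_id * fix_hub (leaf_part a) by apply: BM.
  apply: endo_ext => [|i]; rewrite endoM ?drop_hubE // drop_hub_leaf /=.
  rewrite fix_hub_leaf leaf_partE; case ai: (a @ leaf i) (noh i) => [w|] //=.
  by case: (vertexP w) => // x _; rewrite liftK.
have [x ax] := missed_leaf ai0.
(* The missed leaf [x] stands in for the hub as a value, and [leaf_to_hub x] then moves it there
   without disturbing the other values. *)
pose p : PT leaves :=
  [ffun i => if a @ leaf i == Some hub then Some x else leaf_part a i].
have pE i : p i = if a @ leaf i == Some hub then Some x else leaf_part a i.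
  exact: ffunE.
suff -> : a = fix_hub p * leaf_to_hub x by apply: BM.
apply: endo_ext => [|i]; rewrite endoM.
  by rewrite fix_hubE /= drop_hubE.
rewrite fix_hub_leaf pE; have [->|] := eqVneq (a @ leaf i) (Some hub).
  by rewrite /= drop_hub_leaf eqxx.
rewrite leaf_partE; case ai: (a @ leaf i) (ax i) => [w|] //=.
case: (vertexP w) => // j jx _; rewrite liftK /= drop_hub_leaf.
by case: (eqVneq j x) jx => // ->; rewrite eqxx.
Qed.

(** * Injectivity on a set of leaves *)

Implicit Types S : {set leaves}.

(** The first clause matters because [None] counts as a value: the second alone would allow one
    undefined leaf. *)
Definition total_inj S a : bool :=
  [forall i in S, a @ leaf i != None] &&
  [forall i in S, forall j in S, (a @ leaf i == a @ leaf j) ==> (i == j)].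

Lemma total_injP S a :
  reflect ({in S, forall i, a @ leaf i <> None} /\
           {in S &, injective (fun i => a @ leaf i)})
          (total_inj S a).
Proof.
apply: (iffP andP) => -[aS ainj]; split.
- by move=> i Si; apply/eqP; apply: (forall_inP aS i Si).
- move=> i j Si Sj /eqP aij.
  by have /forall_inP/(_ j Sj)/implyP/(_ aij)/eqP := forall_inP ainj i Si.
- by apply/forall_inP=> i Si; apply/eqP/aS.
- apply/forall_inP=> i Si; apply/forall_inP=> j Sj; apply/implyP=> /eqP aij.
  by apply/eqP/ainj.
Qed.

Lemma total_injM S a b : total_inj S (a * b) -> total_inj S a.
Proof.
move/total_injP=> [abS abI]; apply/total_injP; split=> [i Si ai|i j Si Sj aij].
  by apply: (abS i) => //; rewrite endoM ai.
by apply: abI => //; rewrite !endoM; move: aij => /= ->.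
Qed.

(** The assumption on [a] concerns the leaves only, so it covers units and also their restrictions
    to the leaves. *)
Lemma total_inj_permM S s a b :
  (forall i, a @ leaf i = Some (leaf (s i))) ->
  total_inj S (a * b) = total_inj [set s i | i in S] b.
Proof.
move=> aE; have abE i : (a * b) @ leaf i = b @ leaf (s i) by rewrite endoM aE.
apply/total_injP/total_injP=> -[bS bI]; split.
- by move=> _ /imsetP[i Si ->]; rewrite -abE; apply: bS.
- move=> _ _ /imsetP[i Si ->] /imsetP[j Sj ->].
  by rewrite -!abE => /bI->.
- by move=> i Si; rewrite abE; apply: bS; apply: imset_f.
- move=> i j Si Sj; rewrite !abE => /bI/perm_inj-> //; exact: imset_f.
Qed.

Lemma imset_permT s : [set s i | i in [set: leaves]] = setT.
Proof.
by apply/setP=> i; rewrite inE; apply/imsetP; exists (s^-1 i); rewrite ?inE ?permKV.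
Qed.

Lemma imset_perm_setC1 s x : [set s i | i in [set~ x]] = [set~ s x].
Proof.
apply/setP=> i; rewrite -(permKV s i) mem_imset ?inE; last exact: perm_inj.
by rewrite (inj_eq perm_inj).
Qed.

(** If the hub went to a leaf, two leaves of [S] would both have to go to the hub. *)
Lemma total_inj_fix_hub S a :
  1 < #|S| -> total_inj S a -> a @ hub != None -> a @ hub = Some hub.
Proof.
move=> /card_gt1P[i [j [Si Sj ij]]] /total_injP[aS aI].
case ah: (a @ hub) => [u|] // _; case: (vertexP u) ah => // x ah.
case/eqP: ij; apply: aI => //=.
case ai: (a @ leaf i) (aS i Si) => [v|] // _.
case aj: (a @ leaf j) (aS j Sj) => [w|] // _.
have := endoP ah ai; have := endoP ah aj.
by case: (vertexP v); case: (vertexP w).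
Qed.

(** * Units, the five sets and their behaviour under products *)

Definition to_hub a : bool := [exists i, a @ leaf i == Some hub].

Lemma to_hubI a i : a @ leaf i = Some hub -> to_hub a.
Proof. by move=> ai; apply/existsP; exists i; rewrite ai. Qed.

(* The first predicate defines the units, the other five the sets X, in the
   order: restrictions to the leaves of units; injections of the leaves with
   the hub in their image; maps swapping the ends of some edge; total maps of
   rank n - 1; units with one leaf dropped. *)
Definition unit_endo a : bool := total_inj setT a && (a @ hub != None).

Definition no_hub_endo a : bool :=
  [&& total_inj setT a, a @ hub == None & ~~ to_hub a].

Definition leaf_to_hub_endo a : bool := total_inj setT a && to_hub a.

Definition swap_hub_endo a : bool := (a @ hub != None) && to_hub a.

Definition fold_endo a : bool :=
  [&& [exists x, total_inj [set~ x] a], ~~ total_inj setT a &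
      [forall v, a @ v != None]].

Definition drop_leaf_endo a : bool :=
  (a @ hub != None) &&
  [exists x, total_inj [set~ x] a && (a @ leaf x == None)].

Lemma cardC1_gt1 x : 1 < #|[set~ x]|. Proof. by rewrite cardsC1 card_ord. Qed.

Lemma cardT_gt1 : 1 < #|[set: leaves]|. Proof. by rewrite cardsT card_ord. Qed.

Lemma total_inj_perm a : total_inj setT a -> ~~ to_hub a ->
  exists s, forall i, a @ leaf i = Some (leaf (s i)).
Proof.
move=> /total_injP[aT aI] /existsPn aN.
pose f i := odflt i (leaf_part a i).
have fE i : a @ leaf i = Some (leaf (f i)).
  rewrite /f leaf_partE.
  case: (a @ leaf i) (aT i (in_setT _)) (aN i) => [v|] // _.
  by case: (vertexP v) => // x _; rewrite /= liftK.
have f_inj : injective f.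
  by move=> i j fij; apply: aI; rewrite ?inE // !fE fij.
by exists (perm f_inj) => i; rewrite permE fE.
Qed.

(** The hub is fixed, hence no leaf goes to it, and an injection of the finite set of leaves into
    itself is a permutation. *)
Lemma total_inj_unit a :
  total_inj setT a -> a @ hub != None -> exists s, a = perm_endo s.
Proof.
move=> aI ah; have ahub := total_inj_fix_hub cardT_gt1 aI ah.
have [|s aE] := total_inj_perm aI.
  by apply/existsPn=> i; apply/eqP=> /(endoP ahub).
by exists s; apply: endo_ext => [|i]; rewrite ?fix_hubE ?perm_endo_leaf.
Qed.

Lemma unit_endoP a : reflect (exists s, a = perm_endo s) (unit_endo a).
Proof.
apply: (iffP andP) => [[aI ah]|[s ->]]; first exact: total_inj_unit.
split; last by rewrite fix_hubE.
apply/total_injP; split=> [i _|i j _ _]; rewrite !perm_endo_leaf //.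
by move=> /Some_inj/leaf_inj/perm_inj.
Qed.

Lemma perm_endoM_hub s b : (perm_endo s * b) @ hub = b @ hub.
Proof. by rewrite endoM fix_hubE. Qed.

Lemma unit_endoM a b : unit_endo (a * b) -> unit_endo a && unit_endo b.
Proof.
move=> /andP[abI abh].
have ua : unit_endo a.
  rewrite /unit_endo (total_injM abI); move: abh; rewrite endoM.
  by case: (a @ hub).
rewrite ua; have [s aE] := unit_endoP _ ua; rewrite aE in abI abh.
rewrite (total_inj_permM _ _ (perm_endo_leaf s)) imset_permT in abI.
by rewrite /unit_endo abI -(perm_endoM_hub s).
Qed.

(** If [a] is not injective on the leaves it is itself in the set; otherwise it is a unit, and
    cancelling it carries the property to [b]. *)
Lemma fold_endo_prime a b : fold_endo (a * b) -> fold_endo a || fold_endo b.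
Proof.
case/and3P=> /existsP[x abx] abI /forallP abT.
have aT v : a @ v != None by have := abT v; rewrite endoM; case: (a @ v).
have [aI|aI] := boolP (total_inj setT a); last first.
  rewrite /fold_endo aI (introT existsP); last by exists x; apply: total_injM abx.
  by rewrite (introT forallP).
have [s aE] := total_inj_unit aI (aT hub); rewrite orbC aE in abx abI abT *.
rewrite (total_inj_permM _ _ (perm_endo_leaf s)) imset_permT in abI.
rewrite (total_inj_permM _ _ (perm_endo_leaf s)) imset_perm_setC1 in abx.
rewrite /fold_endo abI (introT existsP) /=; last by exists (s x).
rewrite (introT forallP) // => v; case: (vertexP v) => [|i].
  by rewrite -(perm_endoM_hub s).
by rewrite -(permKV s i) -perm_endoM_leaf.
Qed.

Lemma drop_leaf_endo_prime a b :
  drop_leaf_endo (a * b) -> drop_leaf_endo a || drop_leaf_endo b.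
Proof.
case/andP=> abh /existsP[x /andP[abx /eqP abxN]].
have aIx := total_injM abx.
have ah : a @ hub != None by move: abh; rewrite endoM; case: (a @ hub).
case ax: (a @ leaf x) => [v|]; last first.
  by rewrite /drop_leaf_endo ah (introT existsP) //; exists x; rewrite aIx ax.
(* A leaf with the same value as [x] under [a] would be undefined under [a * b], as [x] is. So [a]
   is injective on all leaves, hence a unit. *)
have aI : total_inj setT a.
  have [aS ainj] := total_injP _ _ aIx.
  have [abS _] := total_injP _ _ abx.
  have neq i : i != x -> a @ leaf i <> a @ leaf x.
    move=> ix aix; apply: (abS i); first by rewrite !inE.
    by rewrite endoM aix -endoM.
  apply/total_injP; split=> [i _|i j _ _ /= aij].
    by have [->|ix] := eqVneq i x; [rewrite ax | apply: aS; rewrite !inE].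
  have [ix|ix] := eqVneq i x; have [jx|jx] := eqVneq j x.
  - by rewrite ix jx.
  - by case: (neq j jx); rewrite -aij ix.
  - by case: (neq i ix); rewrite aij jx.
  - by apply: ainj; rewrite ?inE.
have [s aE] := total_inj_unit aI ah; rewrite orbC aE in abx abh abxN *.
rewrite (total_inj_permM _ _ (perm_endo_leaf s)) imset_perm_setC1 in abx.
rewrite /drop_leaf_endo -(perm_endoM_hub s) abh (introT existsP) //.
by exists (s x); rewrite abx -perm_endoM_leaf abxN.
Qed.

(** If [a * b] reverses an edge, then either [a] reverses it, or [a] keeps its direction and [b]
    reverses the image edge. *)
Lemma swap_hub_endo_prime a b :
  swap_hub_endo (a * b) -> swap_hub_endo a || swap_hub_endo b.
Proof.
case/andP=> abh /existsP[i /eqP abi].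
case ah: (a @ hub) abh => [u|]; rewrite endoM ah //= => bu.
move: abi; rewrite endoM; case ai: (a @ leaf i) => [v|] //= bv.
have := endoP ah ai; case: (vertexP u) ah bu => [|x] ah bu.
  case: (vertexP v) ai bv => // y ai bv _; rewrite orbC /swap_hub_endo bu.
  by rewrite (to_hubI bv).
case: (vertexP v) ai bv => // ai bv _; rewrite /swap_hub_endo ah.
by rewrite (to_hubI ai).
Qed.

Lemma to_hubM s a b : (forall i, a @ leaf i = Some (leaf (s i))) ->
  to_hub (a * b) = to_hub b.
Proof.
move=> aE; apply/existsP/existsP=> -[i].
  by rewrite endoM aE /=; exists (s i).
by exists (s^-1 i); rewrite endoM aE /= permKV.
Qed.

(** If [a] sends no leaf to the hub, it permutes the leaves and can be cancelled. *)
Lemma leaf_to_hub_endo_prime a b :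
  leaf_to_hub_endo (a * b) -> leaf_to_hub_endo a || leaf_to_hub_endo b.
Proof.
rewrite /leaf_to_hub_endo => /andP[abI abh]; have aI := total_injM abI.
have [_ /=|aN] := boolP (to_hub a); first by rewrite aI.
have [s aE] := total_inj_perm aI aN.
rewrite (total_inj_permM _ _ aE) imset_permT in abI.
by rewrite abI -(to_hubM _ aE) abh orbT.
Qed.

Lemma no_hub_endo_prime a b :
  no_hub_endo (a * b) -> no_hub_endo a || no_hub_endo b.
Proof.
case/and3P=> abI /eqP abh abN; have aI := total_injM abI.
have [/existsP[i /eqP ai]|aN] := boolP (to_hub a); last first.
  (* Here [a] permutes the leaves: it is in the set if undefined at the hub, and otherwise it is a
     unit and can be cancelled. *)
  have [s aE] := total_inj_perm aI aN.
  rewrite (to_hubM _ aE) in abN.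
  rewrite (total_inj_permM _ _ aE) imset_permT in abI.
  case ah: (a @ hub) => [u|]; last by rewrite /no_hub_endo aI ah aN.
  have [|t aE'] := total_inj_unit aI; first by rewrite ah.
  by rewrite orbC /no_hub_endo abI abN -(perm_endoM_hub t) -aE' abh.
(* Here [b] is injective on the image of [a], which contains the hub and two
   leaves, so [b] would have to fix the hub, against [abN]. *)
have [aS ainj] := total_injP _ _ aI.
have [abS abinj] := total_injP _ _ abI.
have abi : (a * b) @ leaf i = b @ hub by rewrite endoM ai.
case bh: (b @ hub) abi => [v|] abi; last by case: (abS i).
case: (vertexP v) bh abi => [|x] bh abi.
  by rewrite (to_hubI abi) in abN.
(* Now [b] sends the hub to a leaf, hence leaves in its domain to the hub, so two leaves other than
   [i] collide under [a * b]. *)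
have abj j : j \in [set~ i] -> (a * b) @ leaf j = Some hub.
  rewrite !inE => ji; have := abS j (in_setT j); rewrite endoM.
  case aj: (a @ leaf j) => [w|] //=.
  case: (vertexP w) aj => [|y] aj; last first.
    case by_: (b @ leaf y) => [z|] // _.
    by have := endoP bh by_; case: (vertexP z).
  by case/eqP: ji; apply: ainj; rewrite ?inE //= aj ai.
have [j [l [ji li /eqP[]]]] := card_gt1P (cardC1_gt1 i).
by apply: abinj; rewrite ?inE //= !abj.
Qed.

(** * Disjointness of the units and the five sets *)

(** An invariant constant on each of the six sets, with distinct values. The last entry separates
    folds from dropped leaves; its conjunct [~~ to_hub a] keeps it constant on [swap_hub_endo],
    whose members may or may not be total. *)
Definition endo_signature a : bool * bool * bool * bool :=
  (total_inj setT a, a @ hub != None, to_hub a,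
   [forall v, a @ v != None] && ~~ to_hub a).

Lemma unit_endo_signature a :
  unit_endo a -> endo_signature a = (true, true, false, true).
Proof.
move=> /unit_endoP[s aE]; have /andP[aI ah] : unit_endo a.
  by apply/unit_endoP; exists s.
rewrite /endo_signature aI ah.
have -> : to_hub a = false.
  by apply/existsPn=> i; rewrite aE perm_endo_leaf.
rewrite (introT forallP) // => v; rewrite aE.
by case: (vertexP v) => [|i]; rewrite ?fix_hubE ?perm_endo_leaf.
Qed.

Lemma no_hub_endo_signature a :
  no_hub_endo a -> endo_signature a = (true, false, false, false).
Proof.
rewrite /endo_signature => /and3P[-> /eqP ah /negPf->]; rewrite ah.
by congr (_, _); apply/negP=> /andP[/forallP/(_ hub)]; rewrite ah.
Qed.

Lemma leaf_to_hub_endo_signature a :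
  leaf_to_hub_endo a -> endo_signature a = (true, false, true, false).
Proof.
rewrite /endo_signature => /andP[aI ah]; rewrite aI ah andbF.
case aN: (a @ hub) => [u|//]; have [|s aE] := total_inj_unit aI.
  by rewrite aN.
by case/existsP: ah => i; rewrite aE perm_endo_leaf.
Qed.

Lemma fix_hub_to_hub a : a @ hub = Some hub -> to_hub a = false.
Proof. by move=> ah; apply/existsPn=> i; apply/eqP=> /(endoP ah). Qed.

Lemma fold_endo_signature a :
  fold_endo a -> endo_signature a = (false, true, false, true).
Proof.
rewrite /endo_signature => /and3P[/existsP[x ax] /negPf-> aT].
have ah := forallP aT hub; rewrite ah aT.
by rewrite (fix_hub_to_hub (total_inj_fix_hub (cardC1_gt1 x) ax ah)).
Qed.

Lemma drop_leaf_endo_signature a :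
  drop_leaf_endo a -> endo_signature a = (false, true, false, false).
Proof.
rewrite /endo_signature => /andP[ah /existsP[x /andP[ax /eqP axN]]].
rewrite ah (fix_hub_to_hub (total_inj_fix_hub (cardC1_gt1 x) ax ah)).
have -> : total_inj setT a = false.
  by apply/total_injP=> -[/(_ x (in_setT x))]; rewrite axN.
by congr (_, _); apply/negP=> /andP[/forallP/(_ (leaf x))]; rewrite axN.
Qed.

Lemma swap_hub_endo_signature a :
  swap_hub_endo a -> endo_signature a = (false, true, true, false).
Proof.
rewrite /endo_signature => /andP[ah aN]; rewrite ah aN andbF.
have -> // : total_inj setT a = false.
apply/negP=> aI; have := total_inj_fix_hub cardT_gt1 aI ah.
by move/fix_hub_to_hub; rewrite aN.
Qed.

(** * Members of the five sets and two units that do not commute *)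

Lemma total_inj_upd x o : total_inj [set~ x] (fix_hub (PT_upd x o)).
Proof.
have updE i : i \in [set~ x] -> fix_hub (PT_upd x o) @ leaf i = Some (leaf i).
  by rewrite !inE fix_hub_leaf PT_updE => /negPf->.
apply/total_injP; split=> [i /updE->|i j /updE iE /updE jE] //=.
by rewrite iE jE => /Some_inj/leaf_inj.
Qed.

Lemma fold_endo_upd x y : y != x -> fold_endo (fix_hub (PT_upd x (Some y))).
Proof.
move=> yx; apply/and3P; split.
- by apply/existsP; exists x; apply: total_inj_upd.
- apply/total_injP=> -[_ /(_ x y (in_setT _) (in_setT _))].
  rewrite !fix_hub_leaf !PT_updE eqxx (negPf yx) => /(_ erefl) xy.
  by rewrite xy eqxx in yx.
apply/forallP=> v; case: (vertexP v) => [|i]; rewrite ?fix_hubE //.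
by rewrite fix_hub_leaf PT_updE; case: ifP.
Qed.

Lemma drop_leaf_endo_upd x : drop_leaf_endo (fix_hub (PT_upd x None)).
Proof.
rewrite /drop_leaf_endo fix_hubE; apply/existsP; exists x.
by rewrite total_inj_upd fix_hub_leaf PT_updE eqxx.
Qed.

Lemma no_hub_endo_leaves_id : no_hub_endo leaves_id.
Proof.
apply/and3P; split; last by apply/existsPn=> i; rewrite drop_hub_leaf.
  apply/total_injP; split=> [i _|i j _ _]; rewrite !drop_hub_leaf //.
  by move=> /Some_inj/leaf_inj.
by rewrite drop_hubE.
Qed.

Lemma leaf_to_hub_endo_leaf_to_hub x : leaf_to_hub_endo (leaf_to_hub x).
Proof.
apply/andP; split; last by apply: (@to_hubI _ x); rewrite drop_hub_leaf eqxx.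
apply/total_injP; split=> [i _|i j _ _]; rewrite !drop_hub_leaf.
  by case: ifP.
case: eqP => [->|_]; case: eqP => [->|_] // /Some_inj; last exact: leaf_inj.
Qed.

Lemma swap_hub_endo_swap_hub : swap_hub_endo swap_hub.
Proof.
by rewrite /swap_hub_endo swap_hubE (@to_hubI _ ord0) // swap_hub_leaf.
Qed.

Lemma unit_endo_noncommutative :
  exists a b, [/\ unit_endo a, unit_endo b & a * b != b * a].
Proof.
(* With at least three leaves, [ord0], [i1] and [i2] are distinct, and transpositions sharing one
   point do not commute. *)
pose i1 : leaves := lift ord0 ord0; pose i2 : leaves := ord_max.
exists (perm_endo (tperm ord0 i1)), (perm_endo (tperm ord0 i2)); split.
- by apply/unit_endoP; eexists.
- by apply/unit_endoP; eexists.
apply/eqP=> /(congr1 (fun a => a @ leaf ord0)).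
by rewrite !perm_endoM_leaf !tpermL !perm_endo_leaf !tpermD //.
Qed.

(** * The lower bound and the rank *)

Lemma card_generating_ge7 (A : {set M}) : generating A -> 7 <= #|A|.
Proof.
move=> genA.
have [u [v [Au Av uu uv nuv]]] :=
  generating_meets_noncommutative genA unit_endoM unit_endo_noncommutative.
(* With the unit [u] set aside, the other generators still show six signatures: that of units
   through [v], and one for each set. *)
have meets (X : pred M) sig :
    (forall a, X a -> endo_signature a = sig) ->
    sig != (true, true, false, true) ->
    (forall a b, X (a * b) -> X a || X b) -> (exists a, X a) ->
    sig \in [seq endo_signature a | a in A :\ u].
  move=> Xsig sig1 XM Xex.
  have [|a Aa Xa] := generating_meets_prime genA _ XM Xex.
    apply: contra sig1 => /Xsig <-; rewrite unit_endo_signature //.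
    by apply/unit_endoP; exists 1; rewrite perm_endo1.
  rewrite -(Xsig a Xa); apply: image_f; rewrite !inE Aa andbT.
  by apply: contra sig1 => /eqP au; rewrite -(Xsig a Xa) au unit_endo_signature.
rewrite (cardsD1 u) Au ltnS -(size_image endo_signature (A :\ u)).
apply: (@uniq_leq_size _
  [:: (true, true, false, true); (true, false, false, false);
      (true, false, true, false); (false, true, false, true);
      (false, true, false, false); (false, true, true, false)]) => // sig.
rewrite !inE => /or4P[| | |/or3P[]] /eqP->.
- rewrite -(unit_endo_signature uv); apply: image_f.
  by rewrite !inE Av eq_sym nuv.
- apply: (meets no_hub_endo) => //; first exact: no_hub_endo_signature.
    exact: no_hub_endo_prime.
  by eexists; apply: no_hub_endo_leaves_id.
- apply: (meets leaf_to_hub_endo) => //; first exact: leaf_to_hub_endo_signature.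
    exact: leaf_to_hub_endo_prime.
  by eexists; apply: (leaf_to_hub_endo_leaf_to_hub ord0).
- apply: (meets fold_endo) => //; first exact: fold_endo_signature.
    exact: fold_endo_prime.
  by eexists; apply: (@fold_endo_upd ord0 (lift ord0 ord0)).
- apply: (meets drop_leaf_endo) => //; first exact: drop_leaf_endo_signature.
    exact: drop_leaf_endo_prime.
  by eexists; apply: (drop_leaf_endo_upd ord0).
- apply: (meets swap_hub_endo) => //; first exact: swap_hub_endo_signature.
    exact: swap_hub_endo_prime.
  by eexists; apply: swap_hub_endo_swap_hub.
Qed.

Lemma monoid_rank_star : monoid_rank M = 7.
Proof.
apply/monoid_rankP; split; last exact: card_generating_ge7.
exists star_gens; first exact: generating_star_gens.
(* The list bounds the size by 7; the lower bound for this generating set gives equality, so the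
   seven entries are distinct. *)
apply/eqP; rewrite eqn_leq card_generating_ge7 ?generating_star_gens // andbT.
by rewrite cardsE; apply: leq_trans (card_size _) _.
Qed.

End Star.

Theorem theorem3p6 (n : nat) (n_ge4 : 4 <= n) :
  monoid_rank (PEnd (star_graph n)) = 7.
Proof.
case: n n_ge4 => [|[|[|[|k]]]] // _.
exact: monoid_rank_star.
Qed.
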